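(* Let $W$ be a universe and $v$ an assignment in $W$. (1) For every term $t$ of $\mathcal{L}_{RST}^{\{HF\}}$, $\|t\|^W_v\in W$. (2a) If $\varphi$ is a formula of $\mathcal{L}_{RST}^{\{HF\}}$ with $\varphi\succ\{y_1,\dots,y_n\}$ and $n>0$, then $\{\langle a_1,\dots,a_n\rangle\in W^n : \|\varphi\|^W_{v[y_1:=a_1,\dots,y_n:=a_n]}=\mathbf{t}\}\in W$. (2b) If $\varphi\succ\emptyset$ and $\{y_1,\dots,y_n\}\subseteq Fv(\varphi)$, then for every $X\in W$, $\{\langle a_1,\dots,a_n\rangle\in X^n : \|\varphi\|^W_{v[y_1:=a_1,\dots,y_n:=a_n]}=\mathbf{t}\}\in W$.
   Context: The language $\mathcal{L}_{RST}^{\{HF\}}$ is first-order with binary relations $\in,=$, one constant $HF$, connectives $\neg,\wedge,\vee$, the quantifier $\exists$, and set-abstraction terms. Terms, formulas and the safety relation $\varphi\succ\Theta$ (a relation between a formula and a finite set of variables) are defined simultaneously: terms are the variables, $HF$, and $\{x\mid\varphi\}$ whenever $\varphi\succ\{x\}$ ($x$ becomes bound; $Fv(\{x\mid\varphi\})=Fv(\varphi)\setminus\{x\}$); atomic formulas are $t=s$ and $t\in s$ for terms $t,s$; formulas are closed under $\neg,\wedge,\vee,\exists x$. Safety rules: every atomic formula is $\succ\emptyset$; if $x\notin Fv(t)$, each of $x\neq x$, $x\in t$, $x=t$, $t=x$ is $\succ\{x\}$; if $\varphi\succ\emptyset$ then $\neg\varphi\succ\emptyset$; if $\varphi\succ\Theta$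 and $\psi\succ\Theta$ then $\varphi\vee\psi\succ\Theta$; if $\varphi\succ\Theta$, $\psi\succ\Phi$ and ($\Phi\cap Fv(\varphi)=\emptyset$ or $\Theta\cap Fv(\psi)=\emptyset$) then $\varphi\wedge\psi\succ\Theta\cup\Phi$; if $\varphi\succ\Theta$ and $y\in\Theta$ then $\exists y\varphi\succ\Theta\setminus\{y\}$. Pairs are $\langle s,t\rangle=\{\{s\},\{s,t\}\}$ and $\langle a_1,\dots,a_n\rangle=\langle\langle a_1,\dots,a_{n-1}\rangle,a_n\rangle$. $\mathcal{HF}$ is the set of hereditarily finite sets. The HF-rudimentary functions are the functions obtained by composition from $F_0(x,y)=\{x,y\}$, $F_1(x,y)=x\setminus y$, $F_2(x,y)=x\times y$, $F_3(x,y)=\{\langle u,z,v\rangle: z\in x,\ \langle u,v\rangle\in y\}$, $F_4(x,y)=\{\langle z,v,u\rangle: z\in x,\ \langle u,v\rangle\in y\}$, $F_5(x,y)=\{\{w:\exists u\in z\,\langle u,w\rangle\in x\}: z\in y\}$, $F_6(x)=\bigcup x$, $F_7(x)=\{v:\exists w\,\langle v,w\rangle\in x\}$, $F_8(x)=\{\langle u,v\rangle: u\in x, v\in x, u\in v\}$, and the constant function $F_9(x)=\mathcal{HF}$. A universe is a transitive collection of sets closed under all HF-rudimentary functions, viewed as a structure interpreting $\in,=$ standardly and $HF$ as $\mathcal{HF}$. For an assignment $v$ in $W$, values are defined recursively: $\|x\|^W_v=v(x)$; $\|HF\|^W_v=\mathcal{HF}$; $\|\{x\mid\varphi\}\|^W_v=\{a\in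 W:\|\varphi\|^W_{v[x:=a]}=\mathbf{t}\}$; $\|t=s\|^W_v=\mathbf{t}$ iff $\|t\|^W_v=\|s\|^W_v$; $\|t\in s\|^W_v=\mathbf{t}$ iff $\|t\|^W_v\in\|s\|^W_v$; $\neg,\wedge,\vee$ are classical; $\|\exists x\varphi\|^W_v=\mathbf{t}$ iff $\|\varphi\|^W_{v[x:=a]}=\mathbf{t}$ for some $a\in W$. Here $v[x:=a]$ is the $x$-variant of $v$ assigning $a$ to $x$. *)

(* Defs.v *)
From HB Require Import structures.
From mathcomp Require Import all_boot finmap.
From mathcomp Require Import boolp classical_sets functions cardinality.

Set Implicit Arguments.
Unset Strict Implicit.
Unset Printing Implicit Defensive.

Local Open Scope classical_set_scope.
Local Open Scope quotient_scope.

(** [V] is Aczel's type of well-founded trees modulo bisimilarity, so that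
    equality of sets is Leibniz equality.  Classes are predicates [set V]. *)

Inductive tree : Type := sup (A : Type) (f : A -> tree).

Fixpoint bisim (s t : tree) : Prop :=
  match s, t with
  | sup A f, sup B g =>
      (forall a, exists b, bisim (f a) (g b)) /\
      (forall b, exists a, bisim (f a) (g b))
  end.

Lemma bisim_refl t : bisim t t.
Proof. by elim: t => A f IH; split=> a; exists a. Qed.

Lemma bisim_sym s t : bisim s t -> bisim t s.
Proof.
elim: s t => A f IH [B g] /= [fg gf].
split=> [b|a]; first by have [a /IH ?] := gf b; exists a.
by have [b /IH ?] := fg a; exists b.
Qed.

Lemma bisim_trans s t u : bisim s t -> bisim t u -> bisim s u.
Proof.
elim: s t u => A f IH [B g] [C h] /= [fg gf] [gh hg]; split=> [a|c].
  by have [b ab] := fg a; have [c bc] := gh b; exists c; exact: IH ab bc.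
by have [b bc] := hg c; have [a ab] := gf b; exists a; exact: IH ab bc.
Qed.

HB.instance Definition _ := gen_eqMixin tree.
HB.instance Definition _ := gen_choiceMixin tree.

Definition bisimb : rel tree := fun s t => `[< bisim s t >].

Lemma bisimb_refl : reflexive bisimb.
Proof. by move=> t; apply/asboolP/bisim_refl. Qed.

Lemma bisimb_sym : symmetric bisimb.
Proof. by move=> s t; apply/asboolP/asboolP => /bisim_sym. Qed.

Lemma bisimb_trans : transitive bisimb.
Proof.
by move=> t s u /asboolP st /asboolP tu; apply/asboolP; exact: bisim_trans st tu.
Qed.

Canonical bisim_equiv := EquivRel bisimb bisimb_refl bisimb_sym bisimb_trans.

Definition V : Type := {eq_quot bisim_equiv}.
HB.instance Definition _ := Choice.on V.
HB.instance Definition _ := Quotient.on V.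

Definition elems (y : V) : set V :=
  let: sup A f := repr y in range (fun i : A => \pi_V (f i)).

Notation "x ∈ y" := (elems y x) (at level 70, no associativity).

Lemma pi_eq (s t : tree) : (\pi_V s = \pi_V t) <-> bisim s t.
Proof.
split=> [/(eqmodP bisim_equiv)/asboolP//|st].
by apply/(eqmodP bisim_equiv)/asboolP.
Qed.

Lemma elems_pi A (f : A -> tree) :
  elems (\pi_V (sup f)) = range (fun i => \pi_V (f i)).
Proof.
have: bisim (repr (\pi_V (sup f))) (sup f) by apply/pi_eq; rewrite reprK.
rewrite /elems; case: (repr _) => B g [gf fg]; apply/seteqP; split=> x [i _ <-].
  by have [a ?] := gf i; exists a => //; apply/esym/pi_eq.
by have [b ?] := fg i; exists b => //; apply/pi_eq.
Qed.

Lemma elems_inj : injective elems.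
Proof.
move=> x y; rewrite /elems -{2}[x]reprK -{2}[y]reprK.
case: (repr x) (repr y) => A f [B g] fg; apply/pi_eq; split=> [a|b].
  have: range (fun i => \pi_V (f i)) (\pi_V (f a)) by exists a.
  by rewrite fg => -[b _ ?]; exists b; apply/pi_eq.
have: range (fun i => \pi_V (g i)) (\pi_V (g b)) by exists b.
by rewrite -fg => -[a _ ?]; exists a; apply/pi_eq.
Qed.

Lemma mem_wf : well_founded (fun x y : V => x ∈ y).
Proof.
move=> x; rewrite -[x]reprK; elim: (repr x) => A f IH; constructor=> y.
by rewrite elems_pi => -[a _ <-].
Qed.

Definition vempty : V := \pi_V (sup (of_void tree)).

(** The set whose members form the class [P].  It is meaningful only when [P]
    is small, and [vempty] otherwise; every comprehension used below is shown
    to be small. *)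
Definition compr (P : set V) : V := xget vempty [set x | elems x = P].

Lemma comprE A (f : A -> V) (P : set V) :
  P `<=` range f -> elems (compr P) = P.
Proof.
move=> Pf.
have: exists x, [set x | elems x = P] x by
  exists (\pi_V (sup (fun i : {i | P (f i)} => repr (f (sval i))))) => /=;
  rewrite elems_pi; apply/seteqP; split=> [x [[i Pi] _] /= <-|x Px];
  [by rewrite reprK | have [i _ fi] := Pf x Px; subst x;
   by exists (exist _ i Px) => //=; rewrite reprK].
by move/(xgetPex vempty).
Qed.

Definition upair (x y : V) : V := compr [set z | z = x \/ z = y].
Definition opair (x y : V) : V := upair (upair x x) (upair x y).

(** [vtuple [:: a1; ..; an]] is the set [<a1, .., an>], associated to the left,
    with [<a1> = a1]; by convention the empty tuple is the empty set. *)
Definition vtuple (s : seq V) : V :=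
  if s is a :: s' then foldl opair a s' else vempty.

Inductive hered_finite : V -> Prop :=
  HeredFinite x of finite_set (elems x) & (forall y, y ∈ x -> hered_finite y) :
    hered_finite x.

Definition HF : V := compr hered_finite.

Definition F0 (x y : V) : V := upair x y.
Definition F1 (x y : V) : V := compr [set z | z ∈ x /\ ~ z ∈ y].
Definition F2 (x y : V) : V :=
  compr [set p | exists u v, [/\ u ∈ x, v ∈ y & p = opair u v]].
Definition F3 (x y : V) : V :=
  compr [set p | exists u z v,
    [/\ z ∈ x, opair u v ∈ y & p = vtuple [:: u; z; v]]].
Definition F4 (x y : V) : V :=
  compr [set p | exists u z v,
    [/\ z ∈ x, opair u v ∈ y & p = vtuple [:: z; v; u]]].
Definition F5 (x y : V) : V :=
  compr [set p | exists2 z, z ∈ y &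
    p = compr [set w | exists2 u, u ∈ z & opair u w ∈ x]].
Definition F6 (x : V) : V := compr [set z | exists2 y, y ∈ x & z ∈ y].
Definition F7 (x : V) : V := compr [set v | exists w, opair v w ∈ x].
Definition F8 (x : V) : V :=
  compr [set p | exists u v, [/\ u ∈ x, v ∈ x, u ∈ v & p = opair u v]].
Definition F9 (x : V) : V := HF.

Definition basic1 : set (V -> V) := [set F6; F7; F8; F9].
Definition basic2 : set (V -> V -> V) :=
  [set F0; F1; F2; F3; F4; F5].

(** As usual for a composition scheme, the projections are available, so that
    arguments may be permuted, identified or ignored. *)
Inductive HF_rud (n : nat) : (n.-tuple V -> V) -> Prop :=
| HF_rud_proj (i : 'I_n) : HF_rud (fun a => tnth a i)
| HF_rud_comp1 F G : basic1 F -> HF_rud G -> HF_rud (fun a => F (G a))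
| HF_rud_comp2 F G H : basic2 F -> HF_rud G -> HF_rud H ->
    HF_rud (fun a => F (G a) (H a)).

Lemma comprS (x : V) (P : set V) : P `<=` elems x -> elems (compr P) = P.
Proof.
by rewrite /elems; case: (repr x) => A f; exact: comprE.
Qed.

Lemma elems_image (x : V) (f : V -> V) :
  elems (compr (f @` elems x)) = f @` elems x.
Proof.
rewrite /elems; case: (repr x) => A g.
by apply: (@comprE A (fun i => f (\pi_V (g i)))) => _ [_ [i _ <-] <-]; exists i.
Qed.

Lemma elems_vempty : elems vempty = set0.
Proof. by rewrite elems_pi; apply/seteqP; split=> // x [[]]. Qed.

Lemma elems_upair x y : elems (upair x y) = [set z | z = x \/ z = y].
Proof.
apply: (@comprE bool (fun b => if b then x else y)) => z [] ->.
  by exists true.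
by exists false.
Qed.

Lemma elems_F1 x y : elems (F1 x y) = [set z | z ∈ x /\ ~ z ∈ y].
Proof. by apply: (@comprS x) => z []. Qed.

Lemma elems_F6 x : elems (F6 x) = [set z | exists2 y, y ∈ x & z ∈ y].
Proof.
pose idx t := let: sup A _ := t in A.
pose sub t : idx t -> tree := let: sup A f := t in f.
have subE y z : z ∈ y -> exists i : idx (repr y), \pi_V (sub _ i) = z.
  by rewrite /elems /sub; case: (repr y) => A f [i _ <-]; exists i.
apply: (@comprE {i : idx (repr x) & idx (repr (\pi_V (sub _ i)))}
  (fun p => \pi_V (sub _ (projT2 p)))) => z [y /subE[i <-] /subE[j <-]].
by exists (existT _ i j).
Qed.

Lemma elems_image2 (x y : V) (f : V -> V -> V) :
  elems (compr [set p | exists u v, [/\ u ∈ x, v ∈ y & p = f u v]]) =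
  [set p | exists u v, [/\ u ∈ x, v ∈ y & p = f u v]].
Proof.
pose g u := compr ((f u) @` elems y).
apply: (@comprS (F6 (compr (g @` elems x)))) => _ [u [v [ux vy ->]]].
rewrite elems_F6; exists (g u); first by rewrite elems_image; exists u.
by rewrite elems_image; exists v.
Qed.

Lemma elems_F2 x y :
  elems (F2 x y) = [set p | exists u v, [/\ u ∈ x, v ∈ y & p = opair u v]].
Proof. exact: elems_image2. Qed.

Lemma opair_mem u v x : opair u v ∈ x -> u ∈ F6 (F6 x) /\ v ∈ F6 (F6 x).
Proof.
move=> uvx; have m2 : upair u v ∈ F6 x.
  by rewrite elems_F6; exists (opair u v) => //; rewrite elems_upair; right.
by split; rewrite elems_F6; exists (upair u v) => //; rewrite elems_upair;
  [left | right].
Qed.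

Lemma elems_F3 x y :
  elems (F3 x y) = [set p | exists u z v,
    [/\ z ∈ x, opair u v ∈ y & p = vtuple [:: u; z; v]]].
Proof.
apply: (@comprS (F2 (F2 (F6 (F6 y)) x) (F6 (F6 y)))) => _ [u [z [v [zx uvy ->]]]].
have [uy vy] := opair_mem uvy; rewrite elems_F2; exists (opair u z), v.
by split=> //; rewrite elems_F2; exists u, z.
Qed.

Lemma elems_F4 x y :
  elems (F4 x y) = [set p | exists u z v,
    [/\ z ∈ x, opair u v ∈ y & p = vtuple [:: z; v; u]]].
Proof.
apply: (@comprS (F2 (F2 x (F6 (F6 y))) (F6 (F6 y)))) => _ [u [z [v [zx uvy ->]]]].
have [uy vy] := opair_mem uvy; rewrite elems_F2; exists (opair z v), u.
by split=> //; rewrite elems_F2; exists z, v.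
Qed.

Lemma elems_rel_image x z :
  elems (compr [set w | exists2 u, u ∈ z & opair u w ∈ x]) =
  [set w | exists2 u, u ∈ z & opair u w ∈ x].
Proof. by apply: (@comprS (F6 (F6 x))) => w [u _ /opair_mem[]]. Qed.

Lemma elems_F5 x y :
  elems (F5 x y) = [set p | exists2 z, z ∈ y &
    p = compr [set w | exists2 u, u ∈ z & opair u w ∈ x]].
Proof.
pose f z := compr [set w | exists2 u, u ∈ z & opair u w ∈ x].
apply: (@comprS (compr (f @` elems y))) => _ [z zy ->].
by rewrite elems_image; exists z.
Qed.

Lemma elems_F7 x : elems (F7 x) = [set v | exists w, opair v w ∈ x].
Proof. by apply: (@comprS (F6 (F6 x))) => v [w /opair_mem[]]. Qed.

Lemma elems_F8 x : elems (F8 x) =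
  [set p | exists u v, [/\ u ∈ x, v ∈ x, u ∈ v & p = opair u v]].
Proof.
apply: (@comprS (F2 x x)) => _ [u [v [ux vx _ ->]]].
by rewrite elems_F2; exists u, v.
Qed.

Inductive ftree : Set := FNode of seq ftree.

Lemma elems_HF : elems HF = hered_finite.
Proof.
pose fix ev (t : ftree) : V :=
  let: FNode s := t in compr [set x | x \in map ev s].
apply: (@comprE ftree ev) => x; elim=> {}x /finite_seqP[s sE] _ IH.
have {}sE y : y ∈ x <-> y \in s by rewrite sE.
have [l ls] : exists l, map ev l = s.
  have : forall y, y \in s -> range ev y by move=> y /sE/IH.
  elim: s {sE} => [|y s IHs] H; first by exists [::].
  have [t _ ty] := H y (mem_head _ _).
  have [|l ls] := IHs; first by move=> z zs; apply: H; rewrite in_cons zs orbT.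
  by exists (t :: l); rewrite /= ty ls.
exists (FNode l) => //=; rewrite ls; apply: elems_inj.
rewrite (@comprS x) => [|y /sE//].
by apply/seteqP; split=> y /sE.
Qed.

(** [W] may be a proper class, i.e. [elems x = W] for no [x : V]. *)
Definition universe (W : set V) : Prop :=
  (forall x y, W x -> y ∈ x -> W y) /\
  (forall n (F : n.-tuple V -> V), HF_rud F ->
     forall a : n.-tuple V, (forall i, W (tnth a i)) -> W (F a)).

Local Open Scope fset_scope.

(** Raw terms and formulas; the grammatical ones are carved out below. *)
Inductive term : Type :=
| Var of nat
| HFc
| Abs of nat & formula
with formula : Type :=
| Eq of term & term
| In of term & term
| Not of formula
| And of formula & formula
| Or of formula & formula
| Ex of nat & formula.

Fixpoint Fvt (t : term) : {fset nat} :=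
  match t with
  | Var x => [fset x]
  | HFc => fset0
  | Abs x p => Fv p `\ x
  end
with Fv (p : formula) : {fset nat} :=
  match p with
  | Eq t s | In t s => Fvt t `|` Fvt s
  | Not p => Fv p
  | And p q | Or p q => Fv p `|` Fv q
  | Ex x p => Fv p `\ x
  end.

Inductive is_term : term -> Prop :=
| is_Var x : is_term (Var x)
| is_HFc : is_term HFc
| is_Abs x p : is_formula p -> safe p [fset x] -> is_term (Abs x p)
with is_formula : formula -> Prop :=
| is_Eq t s : is_term t -> is_term s -> is_formula (Eq t s)
| is_In t s : is_term t -> is_term s -> is_formula (In t s)
| is_Not p : is_formula p -> is_formula (Not p)
| is_And p q : is_formula p -> is_formula q -> is_formula (And p q)
| is_Or p q : is_formula p -> is_formula q -> is_formula (Or p q)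
| is_Ex x p : is_formula p -> is_formula (Ex x p)
with safe : formula -> {fset nat} -> Prop :=
| safe_Eq t s : is_term t -> is_term s -> safe (Eq t s) fset0
| safe_In t s : is_term t -> is_term s -> safe (In t s) fset0
| safe_neq x : safe (Not (Eq (Var x) (Var x))) [fset x]
| safe_xIn x t : is_term t -> x \notin Fvt t -> safe (In (Var x) t) [fset x]
| safe_xEq x t : is_term t -> x \notin Fvt t -> safe (Eq (Var x) t) [fset x]
| safe_Eqx x t : is_term t -> x \notin Fvt t -> safe (Eq t (Var x)) [fset x]
| safe_Not p : safe p fset0 -> safe (Not p) fset0
| safe_Or p q T : safe p T -> safe q T -> safe (Or p q) T
| safe_And p q T U : safe p T -> safe q U ->
    U `&` Fv p = fset0 \/ T `&` Fv q = fset0 -> safe (And p q) (T `|` U)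
| safe_Ex y p T : safe p T -> y \in T -> safe (Ex y p) (T `\ y).

(** The simultaneous variant [v[y1 := a1, .., yn := an]]; should a variable be
    repeated in [ys], its first occurrence prevails. *)
Definition upd (v : nat -> V) (ys : seq nat) (a : seq V) : nat -> V :=
  fun x => nth (v x) a (index x ys).

(** A class is a member of another one when it is a set which belongs to it. *)
Definition cmem (A B : set V) : Prop := exists2 a, elems a = A & B a.

(** The value of a term is a class: that it is a set is part of what has to be
    proved.  A set is identified with the class of its members. *)
Fixpoint denote (W : set V) (v : nat -> V) (t : term) : set V :=
  match t with
  | Var x => elems (v x)
  | HFc => elems HF
  | Abs x p => [set a | W a /\ holds W (upd v [:: x] [:: a]) p]
  end
with holds (W : set V) (v : nat -> V) (p : formula) : Prop :=
  match p with
  | Eq t s => denote W v t = denote W v s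
  | In t s => cmem (denote W v t) (denote W v s)
  | Not p => ~ holds W v p
  | And p q => holds W v p /\ holds W v q
  | Or p q => holds W v p \/ holds W v q
  | Ex x p => exists2 a, W a & holds W (upd v [:: x] [:: a]) p
  end.

(* Main.v *)
(** Call an operation on assignments rudimentary when it is composed from the
    variables, constants of [W] and [F0]-[F9]; its values at assignments in [W]
    lie in [W].  By induction on syntax, the value of a term is rudimentary and
    every safe formula [p], safe for [T], has a rudimentary truth value together
    with a rudimentary bound [B]: any values of the variables of [T] that make
    [p] true at a variant of [v] belong to [B v].  Existential quantifiers and
    abstraction terms are thus bounded, and what remains is that rudimentary
    operations are closed under bounded unions.  For this, one shows by
    induction on [f] that the relation [{<z, w> : z in h, w in f(z)}] is
    rudimentary, using composition, converse and fibers of relations; this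
    relation, unlike the graph of [f], makes most cases immediate. *)

Require Import Defs.
From mathcomp Require Import all_boot finmap.
From mathcomp Require Import boolp classical_sets functions cardinality.

Set Implicit Arguments.
Unset Strict Implicit.
Unset Printing Implicit Defensive.

Local Open Scope classical_set_scope.
Local Open Scope fset_scope.

(** * Membership in the values of the basic functions *)

Lemma mem_irrefl (x : V) : ~ x ∈ x.
Proof. by elim/(well_founded_ind mem_wf): x => x IH xx; exact: (IH x). Qed.

Lemma in_upair x y z : z ∈ upair x y <-> z = x \/ z = y.
Proof. by rewrite elems_upair. Qed.

Lemma upair_inj a b c d :
  upair a b = upair c d -> (a = c /\ b = d) \/ (a = d /\ b = c).
Proof.
move=> e; have m z : z = a \/ z = b <-> z = c \/ z = d.
  by rewrite -!in_upair e.
have [ac|ad] := (m a).1 (or_introl erefl);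
have [bc|bd] := (m b).1 (or_intror erefl); subst; [|by left|by right|].
  by have [->|->] := (m d).2 (or_intror erefl); left.
by have [->|->] := (m c).2 (or_introl erefl); left.
Qed.

Lemma opair_inj a b c d : opair a b = opair c d -> a = c /\ b = d.
Proof.
by move=> /upair_inj[] [/upair_inj e1 /upair_inj e2]; intuition congruence.
Qed.

Lemma in_F1 x y z : z ∈ F1 x y <-> z ∈ x /\ ~ z ∈ y.
Proof. by rewrite elems_F1. Qed.

Lemma in_F2 x y a b : opair a b ∈ F2 x y <-> a ∈ x /\ b ∈ y.
Proof.
rewrite elems_F2; split=> [[u [v [ux vy /opair_inj[-> ->]]]] //|[ax b_y]].
by exists a, b.
Qed.

Lemma in_F3 x y u z v :
  opair (opair u z) v ∈ F3 x y <-> z ∈ x /\ opair u v ∈ y.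
Proof.
rewrite elems_F3; split=> [|[zx uv]]; last by exists u, z, v.
by case=> u' [z' [v' [zx uv /opair_inj[/opair_inj[-> ->] ->]]]].
Qed.

Lemma in_F4 x y u z v :
  opair (opair z v) u ∈ F4 x y <-> z ∈ x /\ opair u v ∈ y.
Proof.
rewrite elems_F4; split=> [|[zx uv]]; last by exists u, z, v.
by case=> u' [z' [v' [zx uv /opair_inj[/opair_inj[-> ->] ->]]]].
Qed.

Lemma in_F6 x z : z ∈ F6 x <-> exists2 y, y ∈ x & z ∈ y.
Proof. by rewrite elems_F6. Qed.

Lemma in_F7 x v : v ∈ F7 x <-> exists w, opair v w ∈ x.
Proof. by rewrite elems_F7. Qed.

Lemma in_F8 x u v : opair u v ∈ F8 x <-> (u ∈ x /\ v ∈ x) /\ u ∈ v.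
Proof.
rewrite elems_F8; split=> [[a [b [ax bx ab /opair_inj[-> ->]]]] //|].
by case=> [[ux vx] uv]; exists u, v.
Qed.

Lemma opairE a b : opair a b = F0 (F0 a a) (F0 a b).
Proof. by []. Qed.

Lemma in_F0 x y z : z ∈ F0 x y <-> z = x \/ z = y.
Proof. exact: in_upair. Qed.

Lemma extV (x y : V) : (forall z, z ∈ x <-> z ∈ y) -> x = y.
Proof. by move=> e; apply: elems_inj; apply/seteqP; split=> z /e. Qed.

(** * A calculus of relations *)

Definition sing1 x := F0 x x.
Definition union2 x y := F6 (F0 x y).
Definition inter x y := F1 x (F1 x y).
(** A set containing the field of [r]: both coordinates of a pair are members of one of its
    members. *)
Definition fld r := F6 (F6 r).

Lemma in_sing1 x z : z ∈ sing1 x <-> z = x.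
Proof. by rewrite in_F0; split=> [[]|->] //; left. Qed.

Lemma in_union2 x y z : z ∈ union2 x y <-> z ∈ x \/ z ∈ y.
Proof.
rewrite in_F6; split=> [[t /in_F0[]->]|[zx|zy]]; [by left|by right| |].
  by exists x => //; rewrite in_F0; left.
by exists y => //; rewrite in_F0; right.
Qed.

Lemma in_inter x y z : z ∈ inter x y <-> z ∈ x /\ z ∈ y.
Proof.
rewrite !in_F1; split=> [[zx n]|[]]; last by intuition.
by split=> //; apply: contrapT => zy; apply: n.
Qed.

Lemma opair_fld u v r : opair u v ∈ r -> u ∈ fld r /\ v ∈ fld r.
Proof. exact: opair_mem. Qed.

(** Both intersected sets consist of triples <x, z, y>, with <x, y> in [r] in the first and <y, z>
    in [s] in the second. The intermediate point comes last, where [F7] erases it. *)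
Definition rcomp r s := F7 (inter (F3 (fld s) r) (F4 (fld r) s)).

Lemma in_rcomp r s x z :
  opair x z ∈ rcomp r s <-> exists y, opair x y ∈ r /\ opair y z ∈ s.
Proof.
rewrite in_F7; split=> -[y]; [rewrite in_inter in_F3 in_F4|].
  by case=> -[_ xy] [_ yz]; exists y.
case=> xy yz; exists y; rewrite in_inter in_F3 in_F4.
by have [? _] := opair_fld xy; have [_ ?] := opair_fld yz.
Qed.

Definition memrel x := inter (F8 (union2 x (F6 x))) (F2 (F6 x) x).

Lemma in_memrel x a b : opair a b ∈ memrel x <-> b ∈ x /\ a ∈ b.
Proof.
rewrite in_inter in_F8 in_F2 !in_union2; split=> [[[_ ?] []] //|[bx ab]].
have ax : a ∈ F6 x by rewrite in_F6; exists b.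
by do !split=> //; [right|left].
Qed.

(* By foundation [x] is not a member of [x], so it can serve as a tag: in
   [opair x v] the tag and the member [v] of [x] cannot be confused. *)
Definition tagrel x :=
  let y := F2 (sing1 x) x in
  inter (rcomp (memrel (F6 y)) (memrel y)) (F2 x y).

Lemma in_tagrel x v q : opair v q ∈ tagrel x <-> v ∈ x /\ q = opair x v.
Proof.
rewrite in_inter in_rcomp in_F2; split=> [[[s []]]|[vx ->]].
  rewrite !in_memrel => -[_ vs] [_ sq] [vx].
  rewrite elems_F2 => -[_ [t [/in_sing1-> tx qE]]]; split=> //.
  (* Here [s] is {x} or {x, t}, so [v] is [x] or [t]; the former would put [x] in itself. *)
  move: sq vs; rewrite qE => /in_F0[]-> /in_F0[]vE //; subst v => //;
    by have := mem_irrefl vx.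
have qy : opair x v ∈ F2 (sing1 x) x by rewrite in_F2 in_sing1.
have vq : F0 x v ∈ opair x v by rewrite in_F0; right.
split=> //; exists (F0 x v); rewrite !in_memrel; split; split=> //.
  by rewrite in_F6; exists (opair x v).
by rewrite in_F0; right.
Qed.

(** [F4] turns <u, v> into <<tag, v>, u>, exchanging the coordinates behind a tag; composition with
    [tagrel] then removes the tag. *)
Definition rconv r := rcomp (tagrel (fld r)) (F4 (sing1 (fld r)) r).

Lemma in_rconv r u v : opair v u ∈ rconv r <-> opair u v ∈ r.
Proof.
rewrite in_rcomp; split=> [[q]|uv].
  by rewrite in_tagrel => -[[_ ->]]; rewrite in_F4 => -[].
exists (opair (fld r) v); rewrite in_tagrel in_F4 in_sing1.
by have [] := opair_fld uv.
Qed.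

(** Tagging is injective, so that tagging followed by its converse is the identity. *)
Definition idrel x := rcomp (tagrel x) (rconv (tagrel x)).

Lemma in_idrel x a b : opair a b ∈ idrel x <-> a ∈ x /\ a = b.
Proof.
rewrite in_rcomp; split=> [[y]|[ax <-]].
  by rewrite in_rconv !in_tagrel => -[[ax ->] [_ /opair_inj[]]].
by exists (opair x a); rewrite in_rconv !in_tagrel.
Qed.

(* As [x] is not a member of [x], the images of [{x}] and [{x, z}] under the
   identity of [x] are the empty set and [{z}]. *)
Definition sings x :=
  F1 (F5 (idrel x) (F6 (F2 (sing1 x) x))) (sing1 (F1 x x)).

Lemma in_sings x s : s ∈ sings x <-> exists2 z, z ∈ x & s = sing1 z.
Proof.
have mE t z : t ∈ compr [set w | exists2 u, u ∈ z & opair u w ∈ idrel x] <->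
    t ∈ z /\ t ∈ x.
  rewrite elems_rel_image; split=> [[u uz /in_idrel[ux <-]] //|[tz tx]].
  by exists t => //; rewrite in_idrel.
rewrite in_F1 in_sing1 elems_F5; split=> [[[z]]|[t tx ->]].
  rewrite in_F6 => -[p]; rewrite elems_F2 => -[_ [t [/in_sing1-> tx ->]]].
  case/in_F0=> -> -> ne.
    case: ne; apply: extV => w; rewrite mE !in_F0 in_F1.
    split=> [[[]-> /mem_irrefl]|[]] //.
  exists t => //; apply: extV => w; rewrite mE in_F0 in_sing1.
  split=> [[[->|] // /mem_irrefl]|->] //; by split=> //; right.
split; last first.
  move=> e; have : t ∈ sing1 t by rewrite in_sing1.
  by rewrite e in_F1 => -[].
exists (F0 x t).
  rewrite in_F6; exists (opair x t); first by rewrite in_F2 in_sing1.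
  by rewrite in_F0; right.
apply: extV => w; rewrite mE in_F0 in_sing1.
by split=> [->|[[->|] // /mem_irrefl]] //; split=> //; right.
Qed.

(** [F5] collects images of sets under a relation; the images of singletons are the fibers. *)
Definition fibers r x := F5 r (sings x).

Lemma in_fibers r x y :
  y ∈ fibers r x <-> exists2 z, z ∈ x & forall w, w ∈ y <-> opair z w ∈ r.
Proof.
have mE z w : w ∈ compr [set w | exists2 u, u ∈ sing1 z & opair u w ∈ r] <->
    opair z w ∈ r.
  rewrite elems_rel_image; split=> [[u /in_sing1->] //|zw].
  by exists z => //; rewrite in_sing1.
rewrite elems_F5; split=> [[s /in_sings[z zx ->] ->]|[z zx yE]].
  by exists z.
exists (sing1 z); first by rewrite in_sings; exists z.
by apply: extV => w; rewrite mE.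
Qed.

(* The two relations taken away consist of the [<z, y>] such that the fiber of
   [r] over [z] is not included in [y], resp. does not include [y]. *)
Definition fibgraph r x :=
  let y := fibers r x in
  F1 (F1 (F2 x y) (rcomp r (F1 (F2 (fld r) y) (memrel y))))
     (rcomp (F1 (F2 x (F6 y)) r) (memrel y)).

Lemma in_fibgraph r x z y :
  opair z y ∈ fibgraph r x <-> z ∈ x /\ forall w, w ∈ y <-> opair z w ∈ r.
Proof.
rewrite /fibgraph; move: (in_fibers r x y); move: (fibers r x) => Y in_Y.
split=> [/in_F1[/in_F1[/in_F2[zx yY] n1] n2]|[zx yE]].
  split=> // w; split=> [wy|zw]; apply: contrapT => n.
    apply: n2; apply/in_rcomp; exists w; split; last exact/in_memrel.
    by apply/in_F1; split=> //; apply/in_F2; split=> //; apply/in_F6; exists y.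
  apply: n1; apply/in_rcomp; exists w; split=> //; apply/in_F1.
  split; last by move=> /in_memrel[_ /n].
  by have [_ ?] := opair_fld zw; apply/in_F2.
have yY : y ∈ Y by apply/in_Y; exists z.
apply/in_F1; split; [apply/in_F1; split; [exact/in_F2|]|];
  move=> /in_rcomp[w []].
  by move=> /yE wy /in_F1[_ []]; apply/in_memrel.
by move=> /in_F1[_ nzw] /in_memrel[_ /yE].
Qed.

(** Inserting [z] into the pairs <u, u> of the identity gives the triples <u, z, u>, that is, <u, z>
    paired with its first coordinate. For [sndrel], [F4] gives <z, u, u> in the same way. *)
Definition fstrel x := inter (F3 (fld x) (idrel (fld x))) (F2 x (fld x)).
Definition sndrel x := inter (F4 (fld x) (idrel (fld x))) (F2 x (fld x)).

Lemma in_fstrel x p u :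
  opair p u ∈ fstrel x <-> p ∈ x /\ exists t, p = opair u t.
Proof.
rewrite in_inter in_F2; split=> [[]|[px [t pE]]].
  rewrite elems_F3 => -[u' [z [v [_ /in_idrel[_ <-] /opair_inj[-> ->]]]]].
  case=> px _.
  by split=> //; exists z.
by subst p; have [? ?] := opair_fld px; rewrite in_F3 in_idrel.
Qed.

Lemma in_sndrel x p u :
  opair p u ∈ sndrel x <-> p ∈ x /\ exists t, p = opair t u.
Proof.
rewrite in_inter in_F2; split=> [[]|[px [t pE]]].
  rewrite elems_F4 => -[u' [z [v [_ /in_idrel[_ <-] /opair_inj[-> ->]]]]].
  case=> px _.
  by split=> //; exists z.
by subst p; have [? ?] := opair_fld px; rewrite in_F4 in_idrel.
Qed.

Definition ran r := F7 (rconv r).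

Lemma in_ran r w : w ∈ ran r <-> exists z, opair z w ∈ r.
Proof. by rewrite in_F7; split=> -[z /in_rconv]; exists z. Qed.

(** A triple is a pair whose first coordinate is a pair; these two relations and [sndrel] extract
    its coordinates, as the cases of [F3] and [F4] require. *)
Definition fstfst x := rcomp (fstrel x) (fstrel (ran (fstrel x))).
Definition sndfst x := rcomp (fstrel x) (sndrel (ran (fstrel x))).

Lemma in_fstfst x q a :
  opair q a ∈ fstfst x <-> q ∈ x /\ exists b c, q = opair (opair a b) c.
Proof.
split=> [/in_rcomp[p [/in_fstrel[qx [c qE]] /in_fstrel[_ [b pE]]]]|].
  by subst p; split=> //; exists b, c.
case=> qx [b [c qE]]; have qf : opair q (opair a b) ∈ fstrel x.
  by apply/in_fstrel; split=> //; exists c.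
apply/in_rcomp; exists (opair a b); split=> //; apply/in_fstrel.
by split; [apply/in_ran; exists q|exists b].
Qed.

Lemma in_sndfst x q b :
  opair q b ∈ sndfst x <-> q ∈ x /\ exists a c, q = opair (opair a b) c.
Proof.
split=> [/in_rcomp[p [/in_fstrel[qx [c qE]] /in_sndrel[_ [a pE]]]]|].
  by subst p; split=> //; exists a, c.
case=> qx [a [c qE]]; have qf : opair q (opair a b) ∈ fstrel x.
  by apply/in_fstrel; split=> //; exists c.
apply/in_rcomp; exists (opair a b); split=> //; apply/in_sndrel.
by split; [apply/in_ran; exists q|exists a].
Qed.

(** * Rudimentary operations on assignments *)

Inductive rud (W : set V) : ((nat -> V) -> V) -> Prop :=
| rud_var i : rud W (fun v => v i)
| rud_const c : W c -> rud W (fun=> c)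
| rud_comp1 F f : basic1 F -> rud W f -> rud W (fun v => F (f v))
| rud_comp2 F f g :
    basic2 F -> rud W f -> rud W g -> rud W (fun v => F (f v) (g v)).

#[local] Create HintDb rud discriminated.
#[local] Hint Constants Opaque : rud.

(* [auto] would be far too slow here, as it unfolds the operations when it
   compares the goal with the hypotheses. *)
Ltac solve_rud := typeclasses eauto with rud nocore.

Section RudOps.
Variable W : set V.
Implicit Types f g h : (nat -> V) -> V.

Lemma rud_F0 f g : rud W f -> rud W g -> rud W (fun v => F0 (f v) (g v)).
Proof. by apply: rud_comp2; rewrite /basic2 /=; tauto. Qed.

Lemma rud_F1 f g : rud W f -> rud W g -> rud W (fun v => F1 (f v) (g v)).
Proof. by apply: rud_comp2; rewrite /basic2 /=; tauto. Qed.

Lemma rud_F2 f g : rud W f -> rud W g -> rud W (fun v => F2 (f v) (g v)).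
Proof. by apply: rud_comp2; rewrite /basic2 /=; tauto. Qed.

Lemma rud_F3 f g : rud W f -> rud W g -> rud W (fun v => F3 (f v) (g v)).
Proof. by apply: rud_comp2; rewrite /basic2 /=; tauto. Qed.

Lemma rud_F4 f g : rud W f -> rud W g -> rud W (fun v => F4 (f v) (g v)).
Proof. by apply: rud_comp2; rewrite /basic2 /=; tauto. Qed.

Lemma rud_F5 f g : rud W f -> rud W g -> rud W (fun v => F5 (f v) (g v)).
Proof. by apply: rud_comp2; rewrite /basic2 /=; tauto. Qed.

Lemma rud_F6 f : rud W f -> rud W (fun v => F6 (f v)).
Proof. by apply: rud_comp1; rewrite /basic1 /=; tauto. Qed.

Lemma rud_F7 f : rud W f -> rud W (fun v => F7 (f v)).
Proof. by apply: rud_comp1; rewrite /basic1 /=; tauto. Qed.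

Lemma rud_F8 f : rud W f -> rud W (fun v => F8 (f v)).
Proof. by apply: rud_comp1; rewrite /basic1 /=; tauto. Qed.

Lemma rud_F9 f : rud W f -> rud W (fun v => F9 (f v)).
Proof. by apply: rud_comp1; rewrite /basic1 /=; tauto. Qed.

Hint Resolve rud_var rud_F0 rud_F1 rud_F2 rud_F3 rud_F4 rud_F5 rud_F6 rud_F7
  rud_F8 rud_F9 : rud.

Lemma rud_opair f g : rud W f -> rud W g -> rud W (fun v => opair (f v) (g v)).
Proof.
move=> rf rg; under eq_fun do rewrite opairE; solve_rud.
Qed.

Lemma rud_sing1 f : rud W f -> rud W (fun v => sing1 (f v)).
Proof. by rewrite /sing1; solve_rud. Qed.

Lemma rud_union2 f g :
  rud W f -> rud W g -> rud W (fun v => union2 (f v) (g v)).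
Proof. by rewrite /union2; solve_rud. Qed.

Lemma rud_inter f g : rud W f -> rud W g -> rud W (fun v => inter (f v) (g v)).
Proof. by rewrite /inter; solve_rud. Qed.

Lemma rud_fld f : rud W f -> rud W (fun v => fld (f v)).
Proof. by rewrite /fld; solve_rud. Qed.
Hint Resolve rud_opair rud_sing1 rud_union2 rud_inter rud_fld : rud.

Lemma rud_rcomp f g : rud W f -> rud W g -> rud W (fun v => rcomp (f v) (g v)).
Proof. by rewrite /rcomp; solve_rud. Qed.

Lemma rud_memrel f : rud W f -> rud W (fun v => memrel (f v)).
Proof. by rewrite /memrel; solve_rud. Qed.
Hint Resolve rud_rcomp rud_memrel : rud.

Lemma rud_tagrel f : rud W f -> rud W (fun v => tagrel (f v)).
Proof. by rewrite /tagrel; solve_rud. Qed.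
Hint Resolve rud_tagrel : rud.

Lemma rud_rconv f : rud W f -> rud W (fun v => rconv (f v)).
Proof. by rewrite /rconv; solve_rud. Qed.
Hint Resolve rud_rconv : rud.

Lemma rud_ran f : rud W f -> rud W (fun v => ran (f v)).
Proof. by rewrite /ran; solve_rud. Qed.

Lemma rud_idrel f : rud W f -> rud W (fun v => idrel (f v)).
Proof. by rewrite /idrel; solve_rud. Qed.
Hint Resolve rud_ran rud_idrel : rud.

Lemma rud_fibers f g :
  rud W f -> rud W g -> rud W (fun v => fibers (f v) (g v)).
Proof. by rewrite /fibers /sings; solve_rud. Qed.
Hint Resolve rud_fibers : rud.

Lemma rud_fibgraph f g :
  rud W f -> rud W g -> rud W (fun v => fibgraph (f v) (g v)).
Proof. by rewrite /fibgraph; solve_rud. Qed.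

Lemma rud_fstrel f : rud W f -> rud W (fun v => fstrel (f v)).
Proof. by rewrite /fstrel; solve_rud. Qed.

Lemma rud_sndrel f : rud W f -> rud W (fun v => sndrel (f v)).
Proof. by rewrite /sndrel; solve_rud. Qed.
Hint Resolve rud_fibgraph rud_fstrel rud_sndrel : rud.

Lemma rud_fstfst f : rud W f -> rud W (fun v => fstfst (f v)).
Proof. by rewrite /fstfst; solve_rud. Qed.

Lemma rud_sndfst f : rud W f -> rud W (fun v => sndfst (f v)).
Proof. by rewrite /sndfst; solve_rud. Qed.
Hint Resolve rud_fstfst rud_sndfst : rud.
End RudOps.

(* Unification must not compare the comprehensions defining these sets. *)
Local Opaque opair F0 F1 F2 F3 F4 F5 F6 F7 F8 F9 sing1 union2 inter fld rcomp
  memrel tagrel rconv idrel sings fibers fibgraph fstrel sndrel ran fstfst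
  sndfst.

#[local] Hint Resolve rud_var rud_F0 rud_F1 rud_F2 rud_F3 rud_F4 rud_F5 rud_F6
  rud_F7 rud_F8 rud_F9 rud_opair rud_sing1 rud_union2 rud_inter rud_rcomp
  rud_memrel rud_rconv rud_ran rud_fibgraph rud_fstrel rud_sndrel rud_fstfst
  rud_sndfst : rud.

(* The basic functions [F0] and [F5] are the ones whose values have new sets as
   members; there one passes from [D] to the graph of its fibers. *)
Lemma rud_restr W i f h : rud W f -> rud W h ->
  exists2 D, rud W D & forall v z w,
    opair z w ∈ D v <-> z ∈ h v /\ w ∈ f (upd v [:: i] [:: z]).
Proof.
move=> rf rh; elim: rf => {f} [j|c Wc|F f bF rf [A rA in_A]|
  F f g bF rf [A rA in_A] rg [B rB in_B]].
- have [<-|ij] := eqVneq i j.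
    (* For [j = i] the value is [z] itself and the relation is converse membership; otherwise the
       value does not depend on [z]. *)
    exists (fun v => rconv (memrel (h v))); first by solve_rud.
    by move=> v z w; rewrite /upd /= eqxx; split=> [/in_rconv/in_memrel|?] //;
      apply/in_rconv/in_memrel.
  exists (fun v => F2 (h v) (v j)); first by solve_rud.
  by move=> v z w; rewrite /upd /= (negPf ij) in_F2.
- exists (fun v => F2 (h v) c); first by apply: rud_F2 => //; exact: rud_const.
  by move=> v z w; rewrite in_F2.
- have in_ranA v z w : opair z w ∈ A v -> w ∈ ran (A v).
    by move=> zw; apply/in_ran; exists z.
  case: bF => [[[->|->]|->]|->].
  + exists (fun v => rcomp (A v) (rconv (memrel (ran (A v)))));
      first by solve_rud.
    move=> v z w; split=> [/in_rcomp[y [/in_A[zh yf]]]|[zh /in_F6[y yf wy]]].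
      by move=> /in_rconv/in_memrel[_ wy]; split=> //; apply/in_F6; exists y.
    have zy : opair z y ∈ A v by apply/in_A.
    apply/in_rcomp; exists y; split=> //; apply/in_rconv/in_memrel.
    by split=> //; exact: in_ranA zy.
  + exists (fun v => rcomp (A v) (fstrel (ran (A v)))); first by solve_rud.
    move=> v z w; split=> [/in_rcomp[p [/in_A[zh pf]]]|[zh /in_F7[t wt]]].
      move=> /in_fstrel[_ [t pE]]; split=> //.
      by apply/in_F7; exists t; rewrite -pE.
    have zp : opair z (opair w t) ∈ A v by apply/in_A.
    apply/in_rcomp; exists (opair w t); split=> //; apply/in_fstrel.
    by split; [exact: in_ranA zp|exists t].
  (* [P v] contains every pair that can occur. Intersecting two compositions over the same [z] puts
     both coordinates of [w] in f(z). *)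
  + pose P v := memrel (ran (A v)).
    exists (fun v => inter (F2 (h v) (P v)) (inter
      (rcomp (A v) (rconv (fstrel (P v))))
      (rcomp (A v) (rconv (sndrel (P v)))))).
      by rewrite /P; solve_rud.
    move=> v z w; split.
      case/in_inter=> /in_F2[zh wP] /in_inter[/in_rcomp[a [/in_A[_ af]]]].
      move=> /in_rconv/in_fstrel[_ [b wE]] /in_rcomp[b' [/in_A[_ bf]]].
      move=> /in_rconv/in_sndrel[_ [a']]; rewrite wE => /opair_inj[_ bE].
      subst b' w; split=> //; apply/in_F8; split=> //.
      by case/in_memrel: wP.
    case=> zh; rewrite elems_F8 => -[a [b [af bf ab wE]]].
    have za : opair z a ∈ A v by apply/in_A.
    have zb : opair z b ∈ A v by apply/in_A.
    have wP : w ∈ P v.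
      by rewrite wE; apply/in_memrel; split=> //; exact: in_ranA zb.
    apply/in_inter; split; first exact/in_F2.
    apply/in_inter; split; apply/in_rcomp.
      by exists a; split=> //; apply/in_rconv/in_fstrel; split=> //; exists b.
    by exists b; split=> //; apply/in_rconv/in_sndrel; split=> //; exists a.
  + exists (fun v => F2 (h v) (F9 (h v))); first by solve_rud.
    by move=> v z w; rewrite in_F2.
have in_ranA v z w : opair z w ∈ A v -> w ∈ ran (A v).
  by move=> zw; apply/in_ran; exists z.
have in_ranB v z w : opair z w ∈ B v -> w ∈ ran (B v).
  by move=> zw; apply/in_ran; exists z.
case: bF => [[[[[->|->]|->]|->]|->]|->].
- exists (fun v => union2 (fibgraph (A v) (h v)) (fibgraph (B v) (h v)));
    first by solve_rud.
  move=> v z w; split=> [/in_union2[]/in_fibgraph[zh wE]|[zh /in_F0[]wE]].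
  + split=> //; apply/in_F0; left; apply: extV => t; rewrite wE in_A.
    by split=> [[]|].
  + split=> //; apply/in_F0; right; apply: extV => t; rewrite wE in_B.
    by split=> [[]|].
  + apply/in_union2; left; apply/in_fibgraph; split=> // t; rewrite in_A wE.
    by split=> [|[]].
  + apply/in_union2; right; apply/in_fibgraph; split=> // t; rewrite in_B wE.
    by split=> [|[]].
- exists (fun v => F1 (A v) (B v)); first by solve_rud.
  move=> v z w; split=> [/in_F1[/in_A[zh wf] n]|[zh /in_F1[wf n]]].
    by split=> //; apply/in_F1; split=> // wg; apply/n/in_B.
  by apply/in_F1; split; [apply/in_A|move=> /in_B[]].
- pose P v := F2 (ran (A v)) (ran (B v)).
  exists (fun v => inter (rcomp (A v) (rconv (fstrel (P v))))
                         (rcomp (B v) (rconv (sndrel (P v))))).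
    by rewrite /P; solve_rud.
  move=> v z w; split.
    case/in_inter=> /in_rcomp[a [/in_A[zh af]]].
    move=> /in_rconv/in_fstrel[_ [b wE]] /in_rcomp[b' [/in_B[_ bf]]].
    move=> /in_rconv/in_sndrel[_ [a']]; rewrite wE => /opair_inj[_ bE].
    by subst b' w; split=> //; apply/in_F2.
  case=> zh; rewrite elems_F2 => -[a [b [af bf wE]]].
  have za : opair z a ∈ A v by apply/in_A.
  have zb : opair z b ∈ B v by apply/in_B.
  have wP : w ∈ P v.
    by rewrite wE; apply/in_F2; split; [exact: in_ranA za|exact: in_ranB zb].
  apply/in_inter; split; apply/in_rcomp.
    by exists a; split=> //; apply/in_rconv/in_fstrel; split=> //; exists b.
  by exists b; split=> //; apply/in_rconv/in_sndrel; split=> //; exists a.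
(* A member of the value is <a, c, b> with c in f(z) and <a, b> in g(z). The inner intersection
   takes [a] and [b] from one and the same pair in g(z). *)
- pose P v := F3 (ran (A v)) (ran (B v)).
  exists (fun v => inter (rcomp (A v) (rconv (sndfst (P v))))
    (rcomp (B v) (inter (rcomp (fstrel (ran (B v))) (rconv (fstfst (P v))))
                        (rcomp (sndrel (ran (B v))) (rconv (sndrel (P v))))))).
    by rewrite /P; solve_rud.
  move=> v z w; split.
    case/in_inter=> /in_rcomp[c [/in_A[zh cf]]].
    move=> /in_rconv/in_sndfst[wP [a [b wE]]] /in_rcomp[r [/in_B[_ r_g]]].
    case/in_inter=> /in_rcomp[a' [/in_fstrel[_ [b' rE]]]].
    move=> /in_rconv/in_fstfst[_ [c' [b'']]]; rewrite wE => /opair_inj[].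
    move=> /opair_inj[a'E _] _ /in_rcomp[b3 [/in_sndrel[_ [a3]]]].
    rewrite {1}rE => /opair_inj[_ b3E] /in_rconv/in_sndrel[_ [p]].
    move=> /opair_inj[_ bE]; subst.
    by split=> //; apply/in_F3.
  case=> zh; rewrite elems_F3 => -[a [c [b [cf abg wE]]]].
  have zc : opair z c ∈ A v by apply/in_A.
  have zab : opair z (opair a b) ∈ B v by apply/in_B.
  have [cr abr] := (in_ranA _ _ _ zc, in_ranB _ _ _ zab).
  rewrite /= in wE; have wP : w ∈ P v by rewrite wE; apply/in_F3.
  apply/in_inter; split; apply/in_rcomp.
    by exists c; split=> //; apply/in_rconv/in_sndfst; split=> //; exists a, b.
  exists (opair a b); split=> //; apply/in_inter; split; apply/in_rcomp.
    exists a; split; first by apply/in_fstrel; split=> //; exists b.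
    by apply/in_rconv/in_fstfst; split=> //; exists c, b.
  exists b; split; first by apply/in_sndrel; split=> //; exists a.
  by apply/in_rconv/in_sndrel; split=> //; exists (opair a c).
- pose P v := F4 (ran (A v)) (ran (B v)).
  exists (fun v => inter (rcomp (A v) (rconv (fstfst (P v))))
    (rcomp (B v) (inter (rcomp (fstrel (ran (B v))) (rconv (sndrel (P v))))
                        (rcomp (sndrel (ran (B v))) (rconv (sndfst (P v))))))).
    by rewrite /P; solve_rud.
  move=> v z w; split.
    case/in_inter=> /in_rcomp[c [/in_A[zh cf]]].
    move=> /in_rconv/in_fstfst[wP [b [a wE]]] /in_rcomp[r [/in_B[_ r_g]]].
    case/in_inter=> /in_rcomp[a' [/in_fstrel[_ [b' rE]]]].
    move=> /in_rconv/in_sndrel[_ [p]]; rewrite wE => /opair_inj[_ a'E].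
    case/in_rcomp=> b3 [/in_sndrel[_ [a3]]].
    rewrite {1}rE => /opair_inj[_ b3E] /in_rconv/in_sndfst[_ [c' [a4]]].
    move=> /opair_inj[/opair_inj[_ bE] _]; subst.
    by split=> //; apply/in_F4.
  case=> zh; rewrite elems_F4 => -[a [c [b [cf abg wE]]]].
  have zc : opair z c ∈ A v by apply/in_A.
  have zab : opair z (opair a b) ∈ B v by apply/in_B.
  have [cr abr] := (in_ranA _ _ _ zc, in_ranB _ _ _ zab).
  rewrite /= in wE; have wP : w ∈ P v by rewrite wE; apply/in_F4.
  apply/in_inter; split; apply/in_rcomp.
    by exists c; split=> //; apply/in_rconv/in_fstfst; split=> //; exists b, a.
  exists (opair a b); split=> //; apply/in_inter; split; apply/in_rcomp.
    exists a; split; first by apply/in_fstrel; split=> //; exists b.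
    by apply/in_rconv/in_sndrel; split=> //; exists (opair c b).
  exists b; split; first by apply/in_sndrel; split=> //; exists a.
  by apply/in_rconv/in_sndfst; split=> //; exists c, a.
(* [M v] relates <z, s>, for s in g(z), to the members of the image of [s] under f(z). Its fibers
   are thus the new members, and the first projection leads from <z, s> back to [z]. *)
- pose M v := rcomp (inter (rcomp (fstrel (B v)) (A v))
    (rcomp (rcomp (sndrel (B v)) (rconv (memrel (ran (B v)))))
           (rconv (fstrel (ran (A v)))))) (sndrel (ran (A v))).
  have in_M v z s w : opair z s ∈ B v -> opair (opair z s) w ∈ M v <->
      exists2 u, u ∈ s & opair u w ∈ f (upd v [:: i] [:: z]).
    move=> zs; split.
      case/in_rcomp=> r [/in_inter[/in_rcomp[z' [/in_fstrel[_ [s' ]]]]]].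
      move=> /opair_inj[<- _] /in_A[_ rf'] /in_rcomp[u [/in_rcomp[s2 []]]].
      move=> /in_sndrel[_ [z2 /opair_inj[_ <-]]] /in_rconv/in_memrel[_ us].
      move=> /in_rconv/in_fstrel[_ [w2 rE]] /in_sndrel[_ [u2]].
      rewrite {1}rE => /opair_inj[_ wE]; exists u => //; by subst.
    case=> u us uw; have zuw : opair z (opair u w) ∈ A v.
      by apply/in_A; split=> //; have [] := (in_B _ _ _).1 zs.
    have ur := in_ranA _ _ _ zuw; have sr := in_ranB _ _ _ zs.
    apply/in_rcomp; exists (opair u w); split; last first.
      by apply/in_sndrel; split=> //; exists u.
    apply/in_inter; split; apply/in_rcomp.
      by exists z; split=> //; apply/in_fstrel; split=> //; exists s.
    exists u; split; last by apply/in_rconv/in_fstrel; split=> //; exists w.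
    apply/in_rcomp; exists s; split; last exact/in_rconv/in_memrel.
    by apply/in_sndrel; split=> //; exists z.
  exists (fun v => rcomp (rconv (fstrel (B v))) (fibgraph (M v) (B v))).
    by rewrite /M; solve_rud.
  move=> v z w; split.
    case/in_rcomp=> p [/in_rconv/in_fstrel[pB [s pE]]] /in_fibgraph[_ wE].
    subst p; have [zh sg] := (in_B _ _ _).1 pB; split=> //.
    rewrite elems_F5; exists s => //; apply: extV => t.
    by rewrite wE in_M // elems_rel_image.
  case=> zh; rewrite elems_F5 => -[s sg wE].
  have zs : opair z s ∈ B v by apply/in_B.
  apply/in_rcomp; exists (opair z s); split.
    by apply/in_rconv/in_fstrel; split=> //; exists s.
  by apply/in_fibgraph; split=> // t; rewrite in_M // wE elems_rel_image.
Qed.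

(** The union is the range of the relation given by [rud_restr]. *)
Lemma rud_bigU W i f h : rud W f -> rud W h ->
  exists2 g, rud W g & forall v w,
    w ∈ g v <-> exists2 z, z ∈ h v & w ∈ f (upd v [:: i] [:: z]).
Proof.
move=> rf rh; have [D rD in_D] := rud_restr i rf rh.
exists (fun v => ran (D v)); first by solve_rud.
move=> v w; split=> [/in_ran[z /in_D[zh wf]]|[z zh wf]]; first by exists z.
by apply/in_ran; exists z; apply/in_D.
Qed.

(** * Variants of assignments *)

Lemma upd1E v i a x : upd v [:: i] [:: a] x = if x == i then a else v x.
Proof. by rewrite /upd /= [i == x]eq_sym; case: (x == i). Qed.

Lemma upd_off n (ys : n.-tuple nat) (a : n.-tuple V) v x :
  x \notin (ys : seq nat) -> upd v ys a x = v x.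
Proof.
by move=> xys; rewrite /upd nth_default // memNindex // !size_tuple.
Qed.

Lemma upd_in n (ys : n.-tuple nat) (a : n.-tuple V) v y :
  y \in (ys : seq nat) -> exists i, upd v ys a y = tnth a i.
Proof.
rewrite -index_mem size_tuple => lt_n; exists (Ordinal lt_n).
by rewrite (tnth_nth (v y)).
Qed.

Lemma upd_tnth n (ys : n.-tuple nat) (a : n.-tuple V) v i :
  uniq ys -> upd v ys a (tnth ys i) = tnth a i.
Proof.
move=> uys; rewrite /upd (tnth_nth 0) index_uniq ?size_tuple //.
by rewrite -tnth_nth.
Qed.

Lemma map_upd n (ys : n.-tuple nat) (a : n.-tuple V) v :
  uniq ys -> map (upd v ys a) ys = a.
Proof.
move=> uys; have -> : map (upd v ys a) ys = map_tuple (upd v ys a) ys by [].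
by congr val; apply: eq_from_tnth => i; rewrite tnth_map upd_tnth.
Qed.

Lemma upd_map ys v v' :
  (forall x, x \notin ys -> v' x = v x) -> upd v ys (map v' ys) = v'.
Proof.
move=> off; apply: funext => x; rewrite /upd.
have [xys|xys] := boolP (x \in ys).
  by rewrite (nth_map 0) ?index_mem // nth_index.
by rewrite nth_default ?size_map ?memNindex // off.
Qed.

Scheme term_formula_ind := Induction for term Sort Prop
with formula_term_ind := Induction for formula Sort Prop.
Combined Scheme syntax_ind from term_formula_ind, formula_term_ind.

Lemma denote_holds_ext W :
  (forall t v v', (forall x, x \in Fvt t -> v x = v' x) ->
     denote W v t = denote W v' t) /\
  (forall p v v', (forall x, x \in Fv p -> v x = v' x) ->
     holds W v p = holds W v' p).
Proof.
have updE i p a v v' : (forall x, x \in Fv p `\ i -> v x = v' x) ->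
    forall x, x \in Fv p -> upd v [:: i] [:: a] x = upd v' [:: i] [:: a] x.
  by move=> e x xp; rewrite !upd1E; case: eqVneq => // xi;
    apply: e; rewrite in_fsetD1 xi.
apply: syntax_ind => /=.
- by move=> x v v' ->; rewrite ?in_fset1.
- by [].
- move=> i p IH v v' e; apply: funext => a /=.
  by congr (_ /\ _); apply: IH; exact: updE.
- by move=> t IHt s IHs v v' e; rewrite (IHt v v') ?(IHs v v') // => x xF;
    apply: e; rewrite in_fsetU xF ?orbT.
- by move=> t IHt s IHs v v' e; rewrite (IHt v v') ?(IHs v v') // => x xF;
    apply: e; rewrite in_fsetU xF ?orbT.
- by move=> p IH v v' e; rewrite (IH v v').
- by move=> t IHt s IHs v v' e; rewrite (IHt v v') ?(IHs v v') // => x xF;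
    apply: e; rewrite in_fsetU xF ?orbT.
- by move=> t IHt s IHs v v' e; rewrite (IHt v v') ?(IHs v v') // => x xF;
    apply: e; rewrite in_fsetU xF ?orbT.
- move=> i p IH v v' e; apply: propext; split=> -[a Wa pa]; exists a => //.
    by rewrite -(IH _ _ (updE _ _ _ _ _ e)).
  by rewrite (IH _ _ (updE _ _ _ _ _ e)).
Qed.

(** * Rudimentary predicates and bounds *)

Definition valid (W : set V) (v : nat -> V) := forall x, W (v x).

(** Truth is coded as non-emptiness, so that disjunctions become unions, conjunctions products, and
    bounded quantifiers bounded unions. *)
Definition rudp W (P : (nat -> V) -> Prop) :=
  exists2 f, rud W f & forall v, valid W v -> (exists w, w ∈ f v) <-> P v.

(** The bound is computed at [v], whose values on [T] are arbitrary, and not at the variant [v']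
    that satisfies [P]; one bound serves for all variables of [T]. *)
Definition bounded W (P : (nat -> V) -> Prop) (T : {fset nat}) :=
  exists2 B, rud W B & forall v v', valid W v -> valid W v' ->
    (forall x, x \notin T -> v' x = v x) -> P v' ->
    forall y, y \in T -> v' y ∈ B v.

(* [v'] arises from [v] by choosing the values of the variables [ys] one after
   the other, each in the value of [B] at the assignment obtained so far. *)
Fixpoint reach (B : (nat -> V) -> V) (ys : seq nat) (v v' : nat -> V) : Prop :=
  if ys is y :: ys' then
    exists2 a, a ∈ B v & reach B ys' (upd v [:: y] [:: a]) v'
  else v' = v.

Lemma rud_reach W B g ys : rud W B -> rud W g ->
  exists2 G, rud W G &
    forall v w, w ∈ G v <-> exists2 v', reach B ys v v' & w ∈ g v'.
Proof.
move=> rB rg; elim: ys => [|y ys [G rG in_G]] /=.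
  by exists g => // v w; split=> [wg|[_ ->]] //; exists v.
have [H rH in_H] := rud_bigU y rG rB; exists H => // v w.
split=> [/in_H[a aB /in_G[v' rv' wg]]|[v' [a aB rv'] wg]].
  by exists v' => //; exists a.
by apply/in_H; exists a => //; apply/in_G; exists v'.
Qed.

(** The empty list stands apart: its tuple is [vempty] by convention, which is a constant once it is
    known to lie in [W]. *)
Lemma rud_vtuple W ys : rud W (fun v => vtuple (map v ys)) \/ ys = [::].
Proof.
case: ys => [|y ys]; [by right|left] => /=.
suff fold_rud f : rud W f -> rud W (fun v => foldl opair (f v) (map v ys)).
  by apply: fold_rud; solve_rud.
by elim: ys f => //= z ys IH f rf; apply: IH; solve_rud.
Qed.

Section Universe.
Variable W : set V.
Hypothesis hW : universe W.
Implicit Types (f g h B : (nat -> V) -> V) (P Q : (nat -> V) -> Prop).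

Lemma universe_mem x y : W x -> y ∈ x -> W y.
Proof. exact: hW.1. Qed.

(** Because of the constants, the closure of [W] is applied to one basic function at a time, at
    values already known to lie in [W]. *)
Lemma universe_rud f v : rud W f -> valid W v -> W (f v).
Proof.
move=> + Wv; elim=> // [F {}f bF _ Wf|F {}f g bF _ Wf _ Wg].
  apply: (hW.2 1 _ (HF_rud_comp1 bF (HF_rud_proj ord0)) [tuple f v]).
  by move=> i; rewrite (tnth_nth vempty) /= ord1.
apply: (hW.2 2 _ (HF_rud_comp2 bF (HF_rud_proj ord0) (HF_rud_proj ord_max))
  [tuple f v; g v]).
by move=> [[|[|i]] ilt]; rewrite (tnth_nth vempty).
Qed.

Lemma valid_upd1 v i a : valid W v -> W a -> valid W (upd v [:: i] [:: a]).
Proof. by move=> Wv Wa x; rewrite upd1E; case: eqP. Qed.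

Lemma universe_rud_mem f v a : rud W f -> valid W v -> a ∈ f v -> W a.
Proof. by move=> rf Wv; apply: universe_mem; exact: universe_rud. Qed.

Lemma valid_upd_rud B v i a :
  rud W B -> valid W v -> a ∈ B v -> valid W (upd v [:: i] [:: a]).
Proof.
by move=> rB Wv aB; apply: valid_upd1 => //; exact: universe_rud_mem aB.
Qed.

Lemma valid_upd n (ys : n.-tuple nat) (a : n.-tuple V) v :
  valid W v -> (forall i, W (tnth a i)) -> valid W (upd v ys a).
Proof.
move=> Wv Wa x; have [xys|xys] := boolP (x \in (ys : seq nat)).
  by have [i ->] := upd_in a v xys.
by rewrite upd_off.
Qed.

Lemma universe_vempty v : valid W v -> W vempty.
Proof.
move=> Wv; suff -> : vempty = F1 (v 0) (v 0).
  by apply: (@universe_rud (fun v => F1 (v 0) (v 0))) => //; solve_rud.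
by apply: extV => z; rewrite elems_vempty; split=> // /in_F1[].
Qed.

(** * Closure of rudimentary predicates; definition by cases and separation *)

Lemma rudp_false : rudp W (fun=> False).
Proof.
exists (fun v => F1 (v 0) (v 0)); first by solve_rud.
by move=> v _; split=> // -[w /in_F1[]].
Qed.

(** With [o v] the singleton of the empty set, the domain of the product of [o v] and [f v] is [o v]
    if [f v] is inhabited and empty otherwise; the complement in [o v] exchanges the two. *)
Lemma rudp_not P : rudp W P -> rudp W (fun v => ~ P v).
Proof.
case=> f rf fP; pose o v := sing1 (F1 (v 0) (v 0)).
exists (fun v => F1 (o v) (F7 (F2 (o v) (f v)))); 
  first by rewrite /o; solve_rud.
move=> v /fP <-; split=> [[w /in_F1[wo n]] [u uf]|n].
  by apply: n; apply/in_F7; exists u; apply/in_F2.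
exists (F1 (v 0) (v 0)); apply/in_F1; split; first exact/in_sing1.
by move=> /in_F7[u /in_F2[_ uf]]; apply: n; exists u.
Qed.

Lemma rudp_or P Q : rudp W P -> rudp W Q -> rudp W (fun v => P v \/ Q v).
Proof.
move=> [f rf fP] [g rg gQ]; exists (fun v => union2 (f v) (g v));
  first by solve_rud.
move=> v Wv; rewrite -(fP v Wv) -(gQ v Wv).
split=> [[w /in_union2[?|?]]|[[w ?]|[w ?]]]; [left|right| |]; exists w => //;
  by apply/in_union2; tauto.
Qed.

Lemma rudp_and P Q : rudp W P -> rudp W Q -> rudp W (fun v => P v /\ Q v).
Proof.
move=> [f rf fP] [g rg gQ]; exists (fun v => F2 (f v) (g v));
  first by solve_rud.
move=> v Wv; rewrite -(fP v Wv) -(gQ v Wv); split=> [[w]|[[a af] [b bg]]].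
  by rewrite elems_F2 => -[a [b [af bg _]]]; split; [exists a|exists b].
by exists (opair a b); apply/in_F2.
Qed.

Lemma rudp_eq f g : rud W f -> rud W g -> rudp W (fun v => f v = g v).
Proof.
move=> rf rg; pose d v := union2 (F1 (f v) (g v)) (F1 (g v) (f v)).
suff [h rh hP] : rudp W (fun v => ~ exists w, w ∈ d v).
  exists h => // v Wv; rewrite hP //; split=> [n|fg]; last first.
    by rewrite /d fg => -[w /in_union2[] /in_F1[]].
  apply: extV => z; split=> zf; apply: contrapT => zg; apply: n; exists z;
    apply/in_union2; [left|right]; exact/in_F1.
by apply: rudp_not; exists d => //; rewrite /d; solve_rud.
Qed.

Lemma rudp_in f g : rud W f -> rud W g -> rudp W (fun v => f v ∈ g v).
Proof.
move=> rf rg; exists (fun v => inter (sing1 (f v)) (g v));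
  first by solve_rud.
move=> v _; split=> [[w /in_inter[/in_sing1 wE wg]]|fg].
  by rewrite -wE.
by exists (f v); apply/in_inter; split=> //; apply/in_sing1.
Qed.

Lemma rudp_ex i B P : rud W B -> rudp W P ->
  rudp W (fun v => exists2 a, a ∈ B v & P (upd v [:: i] [:: a])).
Proof.
move=> rB [f rf fP]; have [g rg in_g] := rud_bigU i rf rB; exists g => // v Wv.
have Wu a : a ∈ B v -> valid W (upd v [:: i] [:: a]) by exact: valid_upd_rud.
split=> [[w /in_g[a aB wf]]|[a aB Pa]].
  by exists a => //; apply/fP; [exact: Wu|exists w].
have [w wf] := (fP _ (Wu _ aB)).2 Pa.
by exists w; apply/in_g; exists a.
Qed.

(** The product of {f(v)} with the truth value of [P] has domain {f(v)} if [P] holds, and empty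
    domain otherwise. *)
Lemma rud_if f P : rud W f -> rudp W P ->
  exists2 g, rud W g & forall v, valid W v ->
    forall w, w ∈ g v <-> w = f v /\ P v.
Proof.
move=> rf [c rc cP]; exists (fun v => F7 (F2 (sing1 (f v)) (c v)));
  first by solve_rud.
move=> v Wv w; rewrite -(cP v Wv).
split=> [/in_F7[u /in_F2[/in_sing1 -> uc]]|[-> [u uc]]].
  by split=> //; exists u.
by apply/in_F7; exists u; apply/in_F2; split=> //; apply/in_sing1.
Qed.

(** Separation is the union over [a] in [B v] of sets that are {a} or empty according to [P]. *)
Lemma rud_sep i B P : rud W B -> rudp W P ->
  exists2 g, rud W g & forall v, valid W v ->
    forall a, a ∈ g v <-> a ∈ B v /\ P (upd v [:: i] [:: a]).
Proof.
move=> rB rP; have [k rk in_k] := rud_if (rud_var W i) rP.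
have [g rg in_g] := rud_bigU i rk rB; exists g => // v Wv w.
have Wu a : a ∈ B v -> valid W (upd v [:: i] [:: a]) by exact: valid_upd_rud.
split=> [/in_g[a aB]|[wB Pw]].
  by move=> /(in_k _ (Wu _ aB))[+ Pa]; rewrite upd1E eqxx => ->.
by apply/in_g; exists w => //; apply/in_k; [exact: Wu|rewrite upd1E eqxx].
Qed.

(** * Assignments reached by bounded choices, and bounds for connectives *)

(** Every intermediate assignment still agrees with [v'] outside [T], so the hypothesis on [B]
    applies again at each choice. *)
Lemma reach_intro B (T : {fset nat}) ys v v' :
  (forall u, valid W u -> (forall x, x \notin T -> v' x = u x) ->
     forall y, y \in T -> v' y ∈ B u) ->
  {subset ys <= T} -> valid W v -> valid W v' ->
  (forall x, x \notin T -> v' x = v x) ->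
  reach B ys v (fun x => if x \in ys then v' x else v x).
Proof.
move=> vB + + Wv'; elim: ys v => [|y ys IH] v //= ysT Wv off.
have yT : y \in T by apply: ysT; rewrite mem_head.
exists (v' y); first exact: vB.
have -> : (fun x => if x \in y :: ys then v' x else v x) =
  (fun x => if x \in ys then v' x else upd v [:: y] [:: v' y] x).
  apply: funext => x; rewrite upd1E in_cons.
  by case: eqVneq => [->|] //=; case: ifP.
apply: IH => [z zys||x xT]; first by apply: ysT; rewrite in_cons zys orbT.
  exact: valid_upd1.
by rewrite upd1E; case: eqVneq => [->|_] //; exact: off.
Qed.

Lemma reach_elim B ys v v' : rud W B -> valid W v -> reach B ys v v' ->
  [/\ valid W v', forall x, x \notin ys -> v' x = v x &
      forall y, y \in ys -> exists u, v' y ∈ B u].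
Proof.
move=> rB; elim: ys v => [v Wv /= -> //|y ys IH v Wv /= [a aB]].
have Wu : valid W (upd v [:: y] [:: a]) by exact: valid_upd_rud aB.
move=> /(IH _ Wu)[Wv' off inB]; split=> // [x|x].
  by rewrite in_cons negb_or => /andP[xy /off ->]; rewrite upd1E (negPf xy).
rewrite in_cons; have [/inB //|xys /orP[/eqP xy|//]] := boolP (x \in ys).
by exists v; rewrite off // upd1E xy eqxx.
Qed.

(** As [P] ignores [U], it already holds once the variables of [T] alone have received their final
    values, which are therefore bounded by [B v]. At each assignment reached in this way [C] bounds
    the variables of [U], and a bounded union collects these bounds. *)
Lemma bounded_and P Q (T U : {fset nat}) : bounded W P T -> bounded W Q U ->
  (forall v v', (forall x, x \notin U -> v x = v' x) -> P v -> P v') ->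
  bounded W (fun v => P v /\ Q v) (T `|` U).
Proof.
move=> [B rB PB] [C rC QC] Pext.
have [G rG in_G] := rud_reach (enum_fset T) rB rC.
exists (fun v => union2 (B v) (G v)); first by solve_rud.
move=> v v' Wv Wv' off [Pv' Qv'] y.
pose v2 x := if x \in T then v' x else v x.
have Wv2 : valid W v2 by move=> x; rewrite /v2; case: ifP.
have off2 x : x \notin T -> v2 x = v x by rewrite /v2 => /negPf ->.
have offU x : x \notin U -> v' x = v2 x.
  by rewrite /v2; case: ifP => // xT xU; apply: off; rewrite in_fsetU xT.
have Pv2 : P v2 by exact: Pext Pv'.
rewrite in_fsetU => /orP[yT|yU]; apply/in_union2.
  by left; have := PB v v2 Wv Wv2 off2 Pv2 y yT; rewrite /v2 yT.
right; apply/in_G; exists v2; last exact: QC.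
have -> : v2 = fun x => if x \in enum_fset T then v2 x else v x.
  by apply: funext => x; rewrite /v2; case: ifP.
by apply: (reach_intro (T := T)) => // u Wu offu; exact: PB.
Qed.

Lemma bounded_ex P T i : bounded W P T -> i \in T ->
  bounded W (fun v => exists2 a, W a & P (upd v [:: i] [:: a])) (T `\ i).
Proof.
move=> [B rB PB] iT; exists B => // v v' Wv Wv' off [a Wa Pa] y.
rewrite in_fsetD1 => /andP[yi yT].
have := PB v _ Wv (valid_upd1 i Wv' Wa) _ Pa y yT.
rewrite upd1E (negPf yi); apply => x xT; rewrite upd1E.
case: eqVneq => [xi|xi]; first by rewrite xi iT in xT.
by apply: off; rewrite in_fsetD1 negb_and xT orbT.
Qed.

Lemma bounded0 P : bounded W P fset0.
(* There is no variable to bound, so the choice of operation is arbitrary. *)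
Proof. by exists (fun v => v 0); first by solve_rud. Qed.

Lemma bounded1 P i B : rud W B ->
  (forall v v', valid W v -> valid W v' ->
    (forall x, x != i -> v' x = v x) -> P v' -> v' i ∈ B v) ->
  bounded W P [fset i].
Proof.
move=> rB PB; exists B => // v v' Wv Wv' off Pv' y; rewrite in_fset1 => /eqP ->.
by apply: PB => // x xi; apply: off; rewrite in_fset1.
Qed.

(** * Values of terms and safe formulas *)

Lemma cmem_elems a b : cmem (elems a) (elems b) <-> a ∈ b.
Proof. by split=> [[c /elems_inj ->]|ab] //; exists a. Qed.

Definition rud_term t :=
  exists2 f, rud W f & forall v, valid W v -> denote W v t = elems (f v).

Lemma rudp_holds_eq t s : rud_term t -> rud_term s ->
  rudp W (fun v => holds W v (Eq t s)).
Proof.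
move=> [f rf fE] [g rg gE]; have [h rh hE] := rudp_eq rf rg.
exists h => // v Wv; rewrite hE //= fE // gE //.
by split=> [->|/elems_inj].
Qed.

Lemma rudp_holds_in t s : rud_term t -> rud_term s ->
  rudp W (fun v => holds W v (In t s)).
Proof.
move=> [f rf fE] [g rg gE]; have [h rh hE] := rudp_in rf rg.
by exists h => // v Wv; rewrite hE //= fE // gE // cmem_elems.
Qed.

Lemma rud_term_var x : rud_term (Var x).
Proof. by exists (fun v => v x); first by solve_rud. Qed.

Lemma denote_off t x v v' : x \notin Fvt t ->
  (forall z, z != x -> v' z = v z) -> denote W v' t = denote W v t.
Proof.
move=> xt off; apply: (denote_holds_ext W).1 => z zt; apply: off.
by apply: contraNneq xt => <-.
Qed.

Lemma holds_off p (T : {fset nat}) v v' : T `&` Fv p = fset0 ->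
  (forall x, x \notin T -> v x = v' x) -> holds W v p -> holds W v' p.
Proof.
move=> Tp off; rewrite ((denote_holds_ext W).2 p v v') // => x xp.
by apply: off; apply/negP => xT; have : x \in T `&` Fv p;
  [rewrite in_fsetI xT|rewrite Tp in_fset0].
Qed.

Lemma rudp_ext P Q : (forall v, valid W v -> P v <-> Q v) ->
  rudp W P -> rudp W Q.
Proof. by move=> PQ [f rf fP]; exists f => // v Wv; rewrite fP // PQ. Qed.

Scheme is_term_mut := Minimality for is_term Sort Prop
with is_formula_mut := Minimality for is_formula Sort Prop
with safe_mut := Minimality for safe Sort Prop.
Combined Scheme grammar_ind from is_term_mut, is_formula_mut, safe_mut.

(** Truth value and bound are proved together, since the bound of the body makes a quantifier or an
    abstraction bounded. Formulas that are not safe may quantify over all of [W], hence nothing is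
    claimed of [is_formula]. *)
Lemma rud_grammar :
  (forall t, is_term t -> rud_term t) /\ (forall p, is_formula p -> True) /\
  (forall p T, safe p T ->
     rudp W (fun v => holds W v p) /\ bounded W (fun v => holds W v p) T).
Proof.
apply: grammar_ind => //.
- exact: rud_term_var.
- exists (fun v => F9 (v 0)); first by solve_rud.
  by move=> v _.
(* The bound for [x] turns the abstraction into separation from the set [B v]. *)
- move=> x p _ _ _ [hp [B rB pB]]; have [f rf fE] := rud_sep x rB hp.
  exists f => // v Wv; apply/seteqP; split=> a /=.
    case=> Wa pa; apply/fE => //; split=> //.
    have := pB v _ Wv (valid_upd1 x Wv Wa) _ pa x (fset11 x).
    rewrite upd1E eqxx; apply => z; rewrite in_fset1 upd1E => /negPf ->.
    by [].
  by move=> /fE[] // aB pa; split=> //; exact: universe_rud_mem aB.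
- by move=> t s _ ht _ hs; split; [exact: rudp_holds_eq|exact: bounded0].
- by move=> t s _ ht _ hs; split; [exact: rudp_holds_in|exact: bounded0].
- move=> x; split.
    by apply: rudp_ext rudp_false => v _ /=; split=> // /(_ erefl).
  (* No assignment satisfies the formula; variable 0 is an arbitrary choice of bound. *)
  by apply: (bounded1 (rud_var W 0)) => v v' _ _ _ /= /(_ erefl).
- move=> x t _ ht xt; split; first exact/rudp_holds_in/ht/rud_term_var.
  (* Since [x] is not free in [t], the value of [t] at [v'] is that at [v], and it bounds [x]; for
     the equations below its singleton does. *)
  case: ht => f rf fE; apply: (bounded1 rf) => v v' Wv Wv' off /=.
  by rewrite (denote_off xt off) fE // cmem_elems.
- move=> x t _ ht xt; split; first exact/rudp_holds_eq/ht/rud_term_var.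
  case: ht => f rf fE; apply: (bounded1 (rud_sing1 rf)) => v v' Wv Wv' off /=.
  by rewrite (denote_off xt off) fE // => /elems_inj xE; apply/in_sing1.
- move=> x t _ ht xt; split; first exact/rudp_holds_eq/rud_term_var.
  case: ht => f rf fE; apply: (bounded1 (rud_sing1 rf)) => v v' Wv Wv' off /=.
  by rewrite (denote_off xt off) fE // => /elems_inj xE; apply/in_sing1.
- by move=> p _ [hp _]; split; [exact: rudp_not|exact: bounded0].
- move=> p q T _ [hp [B rB pB]] _ [hq [C rC qC]]; split; first exact: rudp_or.
  exists (fun v => union2 (B v) (C v)); first by solve_rud.
  move=> v v' Wv Wv' off /= [pv'|qv'] y yT; apply/in_union2.
    by left; exact: pB yT.
  by right; exact: qC yT.
- move=> p q T U _ [hp bp] _ [hq bq] ind; split; first exact: rudp_and.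
  case: ind => [Up|Tq].
    by apply: bounded_and bp bq _ => v v'; exact: holds_off.
  (* Under the second side condition the conjuncts exchange roles. *)
  have [] := bounded_and bq bp (fun v v' => @holds_off q T v v' Tq).
  rewrite fsetUC => B rB qpB; exists B => // v v' Wv Wv' off [pv' qv'].
  exact: qpB.
- move=> y p T _ [hp bp] yT; split; last exact: (bounded_ex bp yT).
  have [B rB pB] := bp; apply: rudp_ext (rudp_ex y rB hp) => v Wv /=.
  split=> [[a aB pa]|[a Wa pa]]; exists a => //.
    exact: universe_rud_mem aB.
  have := pB v _ Wv (valid_upd1 y Wv Wa) _ pa y yT.
  rewrite upd1E eqxx; apply => x xT; rewrite upd1E.
  by case: eqVneq => // xy; rewrite xy yT in xT.
Qed.

(** * Sets of tuples in a universe *)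

(** The set is a bounded union over the reachable assignments [v'], each contributing the tuple of
    its values on [ys] if it satisfies [P]. Distinctness of [ys] makes the tuple contributed by
    [upd v ys a] that of [a]. *)
Lemma cmem_reach n (ys : n.-tuple nat) v B P : valid W v -> uniq ys ->
  rud W B -> rudp W P ->
  cmem [set vtuple a | a in [set a : n.-tuple V |
          reach B ys v (upd v ys a) /\ P (upd v ys a)]] W.
Proof.
move=> Wv uys rB rP.
have rt : rud W (fun v => vtuple (map v ys)).
  have [//|->] := rud_vtuple W ys.
  by apply: rud_const; exact: universe_vempty Wv.
have [g rg in_g] := rud_if rt rP; have [G rG in_G] := rud_reach ys rB rg.
exists (G v); last exact: universe_rud.
apply/seteqP; split=> w.
  case/in_G=> v' rv'; have [Wv' off _] := reach_elim rB Wv rv'.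
  case/(in_g _ Wv') => -> Pv'; exists (map_tuple v' ys) => //=.
  by rewrite upd_map.
case=> a /= [ra Pa] <-; have [Wa _ _] := reach_elim rB Wv ra.
by apply/in_G; exists (upd v ys a) => //; apply/in_g => //; rewrite map_upd.
Qed.

Lemma reach_upd n (ys : n.-tuple nat) (a : n.-tuple V) v B :
  valid W v -> (forall i, W (tnth a i)) ->
  (forall u, valid W u ->
     (forall x, x \notin (ys : seq nat) -> upd v ys a x = u x) ->
     forall y, y \in (ys : seq nat) -> upd v ys a y ∈ B u) ->
  reach B ys v (upd v ys a).
Proof.
move=> Wv Wa aB; have Wu := valid_upd ys Wv Wa.
have -> : upd v ys a =
    fun x => if x \in (ys : seq nat) then upd v ys a x else v x.
  by apply: funext => x; case: ifPn => // xys; rewrite upd_off.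
apply: (reach_intro (T := [fset y in (ys : seq nat)])) => //.
- by move=> u Wu' off y; rewrite in_fset /=; apply: aB => // x xys;
    apply: off; rewrite in_fset.
- by move=> y yys; rewrite in_fset.
- by move=> x; rewrite in_fset => xys; rewrite upd_off.
Qed.
End Universe.

Theorem theorem2p16 (W : set V) (v : nat -> V)
    (hW : universe W) (hv : forall x, W (v x)) :
  (forall t : term, is_term t -> cmem (denote W v t) W)
  /\
  (forall (p : formula) (n : nat) (ys : n.-tuple nat),
     is_formula p -> (0 < n)%N -> uniq ys ->
     safe p [fset y in (ys : seq nat)] ->
     cmem [set vtuple a | a in
             [set a : n.-tuple V | (forall i, W (tnth a i)) /\
                                   holds W (upd v ys a) p]]
          W)
  /\
  (forall (p : formula) (n : nat) (ys : n.-tuple nat),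
     is_formula p -> uniq ys ->
     safe p fset0 -> {subset ys <= Fv p} ->
     forall X : V, W X ->
     cmem [set vtuple a | a in
             [set a : n.-tuple V | (forall i, tnth a i ∈ X) /\
                                   holds W (upd v ys a) p]]
          W).
Proof.
have [term_ok [_ safe_ok]] := rud_grammar hW; split; [|split].
- move=> t /term_ok[f rf fE]; exists (f v); first by rewrite fE.
  exact: (universe_rud hW rf).
- move=> p n ys _ _ uys /safe_ok[hp [B rB pB]].
  (* Truth of [p] confines the chosen values to the bound [B], and reachable values lie in [W], so
     reachability replaces membership in W^n. *)
  suff -> : [set a : n.-tuple V | (forall i, W (tnth a i)) /\
      holds W (upd v ys a) p] =
    [set a : n.-tuple V | reach B ys v (upd v ys a) /\ holds W (upd v ys a) p].
    exact: (cmem_reach hW hv uys rB hp).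
  apply/seteqP; split=> a /= [Wa pa]; split=> //.
    have Wu := valid_upd ys hv Wa.
    apply: (reach_upd hv Wa) => u Wv' off y yys.
    apply: pB => //; last by rewrite in_fset.
    by move=> x; rewrite in_fset => xys; exact: off.
  move=> i; rewrite -(upd_tnth a v i uys).
  by have [Wu _ _] := reach_elim hW rB hv Wa.
- move=> p n ys _ uys /safe_ok[hp _] _ X WX.
  (* With the constant bound [X], reachability amounts to membership of all entries in [X]. *)
  suff -> : [set a : n.-tuple V | (forall i, tnth a i ∈ X) /\
      holds W (upd v ys a) p] =
    [set a : n.-tuple V |
      reach (fun=> X) ys v (upd v ys a) /\ holds W (upd v ys a) p].
    exact: (cmem_reach hW hv uys (rud_const WX) hp).
  apply/seteqP; split=> a /= [Xa pa]; split=> //.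
    apply: (reach_upd hv) => [i|u _ _ y /(upd_in a v)[i ->] //].
    exact: hW.1 (Xa i).
  have [_ _ inX] := reach_elim hW (rud_const WX) hv Xa.
  by move=> i; rewrite -(upd_tnth a v i uys); have [|_] := inX (tnth ys i);
    first exact: mem_tnth.
Qed.
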